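(* Let $R$ be a commutative ring, $\delta\in R$, $n\geq 0$, and $X\subseteq\{1,\dots,n\}$. Suppose that either $\delta$ is invertible in $R$, or $|X|<n$. Then $\mathrm{Tor}_i^{\mathcal P_n}(\mathbb 1,\mathcal P_n/J_X)=0$ for all $i>0$.
   Context: $\mathcal P_n=\mathcal P_n(R,\delta)$ is the partition algebra: the free $R$-module with basis the set partitions (''diagrams'') of $\{-n,\dots,-1,1,\dots,n\}$ (negative elements are left nodes, positive ones right nodes), with product $d_1d_2$ given by identifying the right nodes of $d_1$ with the left nodes of $d_2$, taking the induced partition of the outer nodes by connectivity, and multiplying by $\delta^c$ where $c$ is the number of components consisting solely of middle nodes. A permutation diagram is one all of whose blocks have the form $\{-i,j\}$. The trivial right $\mathcal P_n$-module $\mathbb 1$ is $R$ with permutation diagrams acting as the identity and all other diagrams as $0$. For $X\subseteq\{1,\dots,n\}$, $J_X\subseteq\mathcal P_n$ is the left ideal spanned by all diagrams in which, among the right nodes labelled by elements of $X$, there is at least one singleton block or at least one pair of distinct nodes lying in the same block. *)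

(* Defs.v *)
From HB Require Import structures.
From mathcomp Require Import all_boot all_order all_algebra.
Set Implicit Arguments. Unset Strict Implicit. Unset Printing Implicit Defensive.
Import GRing.Theory.
Local Open Scope ring_scope.

(* Nodes: (false, i) is the left node -(i+1), (true, i) the right node i+1. *)
Definition pt (n : nat) := (bool * 'I_n)%type.

Definition diagram (n : nat) :=
  {d : {set {set pt n}} | partition d [set: pt n]}.

Section PartitionAlgebra.
Variable n : nat.

Definition same_block (d : diagram n) (x y : pt n) : bool :=
  [exists A in val d, (x \in A) && (y \in A)].

(* Stacked nodes: level 0 = left nodes of d1, level 1 = middle nodes
   (right of d1 = left of d2), level 2 = right nodes of d2. *)
Definition cpt := ('I_3 * 'I_n)%type.

Definition cedge (d1 d2 : diagram n) (x y : cpt) : bool :=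
  [|| [&& (x.1 <= 1)%N, (y.1 <= 1)%N &
          same_block d1 (x.1 == 1 :> nat, x.2) (y.1 == 1 :> nat, y.2)]
    | [&& (1 <= x.1)%N, (1 <= y.1)%N &
          same_block d2 (x.1 == 2 :> nat, x.2) (y.1 == 2 :> nat, y.2)]].

Definition outer (p : pt n) : cpt := (if p.1 then ord_max else ord0, p.2).

Definition compose_set (d1 d2 : diagram n) : {set {set pt n}} :=
  [set [set q | connect (cedge d1 d2) (outer p) (outer q)] | p : pt n].

Definition nmid (d1 d2 : diagram n) : nat :=
  #|[set [set y | connect (cedge d1 d2) x y] | x : cpt &
      ((x.1 : nat) == 1%N) && [forall p : pt n, ~~ connect (cedge d1 d2) x (outer p)]]|.

(* underlying diagram of the product d1 d2 (compose_set is always a set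
   partition, so the default d1 of insubd is never used) *)
Definition dcomp (d1 d2 : diagram n) : diagram n := insubd d1 (compose_set d1 d2).

Definition is_perm (d : diagram n) : bool :=
  [forall A in val d, [exists i : 'I_n, exists j : 'I_n,
     A == [set ((false, i) : pt n); (true, j)]]].

(* diagrams spanning J_X *)
Definition inJ (X : {set 'I_n}) (d : diagram n) : bool :=
  [exists x in X, [set ((true, x) : pt n)] \in val d] ||
  [exists x in X, exists y in X, (x != y) && same_block d (true, x) (true, y)].

(* basis of P_n / J_X *)
Definition Nbasis (X : {set 'I_n}) := {d : diagram n | ~~ inJ X d}.

Variables (R : comPzRingType) (delta : R) (X : {set 'I_n}).

(* action of the trivial right module 1 *)
Definition eps (d : diagram n) : R := if is_perm d then 1 else 0.

(* left action of a diagram on a basis element of P_n/J_X, as a formal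
   linear combination *)
Definition act (a : diagram n) (b : Nbasis X) : seq (R * Nbasis X) :=
  match insub (dcomp a (val b)) with
  | Some b' => [:: (delta ^+ nmid a (val b), b')]
  | None => [::]
  end.

(* bar differential on the basis element 1 (x) a_1 (x) ... (x) a_i (x) b of
   1 (x)_R P_n^{(x) i} (x)_R (P_n/J_X) *)
Definition dbasis (s : seq (diagram n)) (b : Nbasis X)
  : seq (R * (seq (diagram n) * Nbasis X)) :=
  match s with
  | [::] => [::]
  | a1 :: rest =>
    (eps a1, (rest, b)) ::
    [seq ((- 1) ^+ k.+1 * delta ^+ nmid (nth a1 s k) (nth a1 s k.+1),
          (take k s ++ dcomp (nth a1 s k) (nth a1 s k.+1) :: drop k.+2 s, b))
      | k <- iota 0 (size s).-1] ++
    [seq ((- 1) ^+ size s * p.1, (belast a1 rest, p.2))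
      | p <- act (last a1 rest) b]
  end.

Definition coefl (l : seq (R * (seq (diagram n) * Nbasis X)))
  (k : seq (diagram n) * Nbasis X) : R :=
  \sum_(p <- l | p.2 == k) p.1.

(* chain group C_i = 1 (x)_{P_n} Bar_i(P_n, P_n/J_X), free on D^i x B *)
Definition chain (i : nat) := {ffun i.-tuple (diagram n) * Nbasis X -> R}.

Definition bd (i : nat) (f : chain i.+1) : chain i :=
  [ffun t : i.-tuple (diagram n) * Nbasis X =>
     \sum_(u : i.+1.-tuple (diagram n) * Nbasis X)
        f u * coefl (dbasis (val u.1) u.2) (val t.1, t.2)].

Definition is_cycle (i : nat) : chain i -> Prop :=
  match i return chain i -> Prop with
  | 0 => fun _ => True
  | j.+1 => fun f => bd f = 0
  end.

Definition is_boundary (i : nat) (f : chain i) : Prop :=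
  exists g : chain i.+1, bd g = f.

Definition Tor_vanishes (i : nat) : Prop :=
  forall f : chain i, is_cycle f -> is_boundary f.

End PartitionAlgebra.

(* Main.v *)
(* All modules involved are subquotients of P_n spanned by diagrams, so everything
   takes place in one bar complex whose basis consists of nonempty words of diagrams;
   the coefficient module is read off the last letter.  A constraint is a right node
   (that should not be a singleton) or a pair of right nodes (that should not lie in the
   same block), and for a set C of constraints M(C) is P_n modulo the diagrams violating
   one of them.  By induction on |C|, the positive homology with coefficients in M(C)
   vanishes: for c in C, the kernel K of M(C \ c) -> M(C) is also the submodule of
   M(C') spanned by the violators of c, where C' is C minus the singleton constraints on
   the two nodes if c is a pair, and C minus the pairs containing x if c is the node x.
   Unlike M(C \ c), M(C') retracts onto K, by right multiplication by a non-permutation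
   idempotent: fusing the two nodes if c is a pair; if c is the node x, either joining
   the left node x to an unconstrained strand z and isolating the right node x, or
   cutting the strand x and dividing by delta.
   Hence K has no homology in any degree, and M(C) inherits vanishing.

   Associativity of the product and additivity of the number of middle components are
   deduced from a faithful representation: a diagram is determined by the relation
   "compatible" between 2-colourings of the left and right nodes, composition of diagrams
   is composition of relations, and the number of intermediate colourings is 2 to the
   number of middle components. *)
Require Import Defs.
From mathcomp Require Import all_boot all_order all_algebra.
From mathcomp Require Import ring.
Set Implicit Arguments. Unset Strict Implicit. Unset Printing Implicit Defensive.
Import GRing.Theory.
Local Open Scope ring_scope.

(** * The bar complex of an algebra with structure constants *)

Section BarComplex.
Variables (R : comPzRingType) (D : finType).
Variables (k : D -> D -> D -> R) (e : D -> R) (one : D).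
Hypothesis kA : forall p q r x,
  \sum_a k p q a * k a r x = \sum_a k q r a * k p a x.
Hypothesis k1 : forall a x, k a one x = (a == x)%:R.
Hypothesis keM : forall a b, \sum_x k a b x * e x = e a * e b.

Implicit Types (F G : seq D -> R) (V W : pred D).

(** Multiplication of the tensor square into the algebra, in coordinates: [H] lists the coefficients
    of a tensor and [push H] those of its product. *)
Definition push (H : D -> D -> R) (x : D) : R :=
  \sum_a \sum_b k a b x * H a b.

(* A chain is given by its coefficients on words [a_1 ... a_i b], of all degrees at once;
   [bar] is the alternating sum of all faces but the first, and [bnd] the differential.
   Only values on nonempty words matter. *)
Fixpoint bar F (t : seq D) {struct t} : R :=
  if t is x :: t' then
    push (fun a b => F [:: a, b & t']) x - bar (fun s => F (x :: s)) t'
  else 0.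

Definition bnd F t := \sum_a e a * F (a :: t) - bar F t.

Lemma eq_push H1 H2 x : H1 =2 H2 -> push H1 x = push H2 x.
Proof.
by move=> eqH; apply: eq_bigr => a _; apply: eq_bigr => b _; rewrite eqH.
Qed.

Lemma push_lin (I : finType) (r : I -> R) (H : I -> D -> D -> R) x :
  push (fun a b => \sum_i r i * H i a b) x = \sum_i r i * push (H i) x.
Proof.
rewrite /push; under [RHS]eq_bigr => i _.
  rewrite mulr_sumr; under eq_bigr => a _ do rewrite mulr_sumr.
  over.
rewrite [RHS]exchange_big; apply: eq_bigr => a _.
rewrite [RHS]exchange_big; apply: eq_bigr => b _.
by rewrite mulr_sumr; apply: eq_bigr => i _; rewrite mulrCA.
Qed.

Lemma pushB H1 H2 x :
  push (fun a b => H1 a b - H2 a b) x = push H1 x - push H2 x.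
Proof.
rewrite /push -sumrB; apply: eq_bigr => a _; rewrite -sumrB.
by apply: eq_bigr => b _; rewrite mulrBr.
Qed.

Lemma pushA (H : D -> D -> D -> R) x :
  push (fun a r => push (fun p q => H p q r) a) x =
  push (fun p a => push (fun q r => H p q r) a) x.
Proof.
rewrite /push.
transitivity (\sum_p \sum_q \sum_r (\sum_a k p q a * k a r x) * H p q r).
  transitivity (\sum_a \sum_p \sum_q \sum_r k p q a * k a r x * H p q r).
    apply: eq_bigr => a _.
    under eq_bigr => r _.
      rewrite mulr_sumr; under eq_bigr => p _ do rewrite mulr_sumr.
      over.
    rewrite exchange_big; apply: eq_bigr => p _.
    rewrite exchange_big; apply: eq_bigr => q _.
    by apply: eq_bigr => r _; rewrite mulrA [k a r x * _]mulrC.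
  rewrite exchange_big; apply: eq_bigr => p _.
  rewrite exchange_big; apply: eq_bigr => q _.
  rewrite exchange_big; apply: eq_bigr => r _.
  by rewrite mulr_suml.
apply: eq_bigr => p _.
transitivity (\sum_a \sum_q \sum_r k q r a * k p a x * H p q r).
  rewrite [RHS]exchange_big; apply: eq_bigr => q _.
  rewrite [RHS]exchange_big; apply: eq_bigr => r _.
  by rewrite kA mulr_suml.
apply: eq_bigr => a _; rewrite mulr_sumr; apply: eq_bigr => q _.
rewrite mulr_sumr; apply: eq_bigr => r _.
by rewrite mulrA [k p a x * _]mulrC.
Qed.

Lemma eq_bar F G t :
  (forall s, size s = (size t).+1 -> F s = G s) -> bar F t = bar G t.
Proof.
elim: t F G => //= x t IH F G eqFG; congr (_ - _).
  by apply: eq_push => a b; apply: eqFG.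
by apply: IH => s st; apply: eqFG; rewrite /= st.
Qed.

Lemma eq_bnd F G t :
  (forall s, size s = (size t).+1 -> F s = G s) -> bnd F t = bnd G t.
Proof.
move=> eqFG; congr (_ - _); last exact: eq_bar.
by apply: eq_bigr => a _; rewrite eqFG.
Qed.

Lemma bar_lin (I : finType) (r : I -> R) (F : I -> seq D -> R) t :
  bar (fun s => \sum_i r i * F i s) t = \sum_i r i * bar (F i) t.
Proof.
elim: t F => [|x t IH] F /=; first by rewrite big1 // => i _; rewrite mulr0.
rewrite push_lin IH -sumrB; apply: eq_bigr => i _.
by rewrite mulrBr.
Qed.

Lemma barB F G t : bar (fun s => F s - G s) t = bar F t - bar G t.
Proof.
elim: t F G => [|x t IH] F G /=; first by rewrite subr0.
by rewrite pushB IH; ring.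
Qed.

Lemma bnd_lin (I : finType) (r : I -> R) (F : I -> seq D -> R) t :
  bnd (fun s => \sum_i r i * F i s) t = \sum_i r i * bnd (F i) t.
Proof.
rewrite /bnd bar_lin; under [RHS]eq_bigr do rewrite mulrBr.
rewrite sumrB; congr (_ - _).
under eq_bigr do rewrite mulr_sumr.
rewrite exchange_big; apply: eq_bigr => i _.
by rewrite mulr_sumr; apply: eq_bigr => a _; rewrite mulrCA.
Qed.

Lemma barZ r F t : bar (fun s => r * F s) t = r * bar F t.
Proof.
transitivity (bar (fun s => \sum_(i : unit) r * F s) t).
  by apply: eq_bar => s _; rewrite big_const card_unit /= addr0.
by rewrite bar_lin big_const card_unit /= addr0.
Qed.

Lemma bndZ r F t : bnd (fun s => r * F s) t = r * bnd F t.
Proof.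
transitivity (bnd (fun s => \sum_(i : unit) r * F s) t).
  by apply: eq_bnd => s _; rewrite big_const card_unit /= addr0.
by rewrite bnd_lin big_const card_unit /= addr0.
Qed.

Lemma bndB F G t : bnd (fun s => F s - G s) t = bnd F t - bnd G t.
Proof.
rewrite /bnd barB; under eq_bigr do rewrite mulrBr.
by rewrite sumrB; ring.
Qed.

Lemma bar_push (H : D -> D -> seq D -> R) x t :
  bar (fun s => push (fun a b => H a b s) x) t = push (fun a b => bar (H a b) t) x.
Proof.
rewrite /push; transitivity (\sum_a 1 * \sum_b k a b x * bar (H a b) t).
  under [in RHS]eq_bigr do rewrite -bar_lin.
  by rewrite -bar_lin; apply: eq_bar => s _; apply: eq_bigr => a _; rewrite mul1r.
by apply: eq_bigr => a _; rewrite mul1r.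
Qed.

(** Expanding both copies of [bar] at the first letter, the mixed terms cancel; what remains
    multiplies three adjacent letters in two ways, which agree by [pushA]. *)
Lemma bar_bar F t : bar (bar F) t = 0.
Proof.
elim: t F => //= x t IH F.
rewrite barB bar_push IH subr0.
rewrite -pushB.
under eq_push => a b.
  rewrite (_ : _ - _ = push (fun p q => F [:: p, q, b & t]) a
             - push (fun p q => F [:: a, p, q & t]) b); last by ring.
  over.
by rewrite pushB pushA subrr.
Qed.

(** Beyond [bar_bar], only the faces that remove the first two letters matter: removing both by [e]
    agrees with multiplying them first because [e] is multiplicative. *)
Lemma bnd_bnd F t : t != [::] -> bnd (bnd F) t = 0.
Proof.
case: t => // x t _; rewrite /bnd barB bar_bar subr0.
under [\sum_a e a * (_ - _)]eq_bigr do rewrite mulrBr.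
rewrite sumrB -/(bar _ _).
have -> : bar (fun s => \sum_a e a * F (a :: s)) (x :: t) =
          \sum_a e a * bar (fun s => F (a :: s)) (x :: t) by rewrite bar_lin.
suff -> : \sum_a e a * (\sum_b e b * F [:: b, a, x & t]) =
          \sum_a e a * push (fun p q => F [:: p, q, x & t]) a.
  rewrite -sumrB -sumrB big1 // => a _ /=; ring.
transitivity (\sum_p \sum_q (e p * e q) * F [:: p, q, x & t]).
  under eq_bigr do rewrite mulr_sumr.
  rewrite exchange_big; apply: eq_bigr => p _; apply: eq_bigr => q _; ring.
under [RHS]eq_bigr => a _.
  rewrite mulr_sumr; under eq_bigr => p _ do rewrite mulr_sumr.
  over.
rewrite [RHS]exchange_big; apply: eq_bigr => p _.
rewrite [RHS]exchange_big; apply: eq_bigr => q _.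
by rewrite -keM mulr_suml; apply: eq_bigr => a _; ring.
Qed.

Definition left_ideal V := forall a b x, V b -> ~~ V x -> k a b x = 0.
(** For a left ideal [W] these chains form the subcomplex with coefficients in the span of [W], the
    last letter carrying the coefficients. *)
Definition ends_in W F := forall a s, ~~ W (last a s) -> F (a :: s) = 0.

Lemma bar_cons F x t : bar F (x :: t) =
  push (fun a b => F [:: a, b & t]) x - bar (fun s => F (x :: s)) t.
Proof. by []. Qed.

Lemma bar_ends_in W F : left_ideal W -> ends_in W F -> ends_in W (bar F).
Proof.
move=> idW + a s; elim: s a F => [|b s IH] a F FW lW.
  rewrite /= subr0 /push big1 // => p _; rewrite big1 // => q _.
  have [Wq|Wq] := boolP (W q); first by rewrite (idW p q a) ?mul0r.
  by rewrite FW ?mulr0.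
rewrite bar_cons IH //; last by move=> ? ? ?; apply: FW.
rewrite subr0 /push big1 // => p _; rewrite big1 // => q _.
by rewrite FW ?mulr0.
Qed.

Lemma bnd_ends_in W F : left_ideal W -> ends_in W F -> ends_in W (bnd F).
Proof.
move=> idW FW a s lW; rewrite /bnd (bar_ends_in idW) // subr0.
by rewrite big1 // => b _; rewrite FW ?mulr0.
Qed.

(** * Right multiplication of the coefficient module as a chain map *)

Section RightMultiplication.
Variables (r : R) (g : D).

Fixpoint rmul F (t : seq D) {struct t} : R :=
  match t with
  | [::] => 0
  | [:: y] => \sum_x r * k x g y * F [:: x]
  | a :: t' => rmul (fun s => F (a :: s)) t'
  end.

Lemma rmul_cons2 F a b t : rmul F [:: a, b & t] = rmul (fun s => F (a :: s)) (b :: t).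
Proof. by []. Qed.

Lemma eq_rmul F G t : (forall s, size s = size t -> F s = G s) -> rmul F t = rmul G t.
Proof.
elim: t F G => // x [|y t] IH F G eqFG.
  by apply: eq_bigr => a _; rewrite eqFG.
by rewrite !rmul_cons2; apply: IH => s st; apply: eqFG; rewrite /= st.
Qed.

Lemma rmul_lin (I : finType) (c : I -> R) (F : I -> seq D -> R) t :
  rmul (fun s => \sum_i c i * F i s) t = \sum_i c i * rmul (F i) t.
Proof.
elim: t F => [|x [|y t] IH] F; first by rewrite big1 // => i _; rewrite mulr0.
  rewrite /=; under eq_bigr do rewrite mulr_sumr.
  rewrite exchange_big; apply: eq_bigr => i _; rewrite mulr_sumr.
  by apply: eq_bigr => a _; rewrite mulrCA.
exact: (IH (fun i s => F i (x :: s))).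
Qed.

Lemma rmulB F G t : rmul (fun s => F s - G s) t = rmul F t - rmul G t.
Proof.
elim: t F G => [|x [|y t] IH] F G; first by rewrite /= subr0.
  by rewrite /= -sumrB; apply: eq_bigr => a _; rewrite mulrBr.
exact: (IH (fun s => F (x :: s))).
Qed.

Lemma rmul_push (H : D -> D -> seq D -> R) x t :
  rmul (fun s => push (fun a b => H a b s) x) t = push (fun a b => rmul (H a b) t) x.
Proof.
rewrite /push; transitivity (\sum_a 1 * \sum_b k a b x * rmul (H a b) t).
  under [in RHS]eq_bigr do rewrite -rmul_lin.
  by rewrite -rmul_lin; apply: eq_rmul => s _; apply: eq_bigr => a _; rewrite mul1r.
by apply: eq_bigr => a _; rewrite mul1r.
Qed.

(** Only the last face involves the letter that [rmul] changes, and there the claim is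
    associativity. *)
Lemma bar_rmul F t : bar (rmul F) t = rmul (bar F) t.
Proof.
elim: t F => // x [|y t] IH F.
  rewrite /= subr0.
  (* Writing [g] as a third tensor factor, through an indicator, puts the sum in the form required
     by [pushA]. *)
  transitivity (r * push (fun a b => push (fun p q => F [:: a; p] * (q == g)%:R) b) x).
    rewrite /push mulr_sumr; apply: eq_bigr => a _.
    rewrite mulr_sumr; apply: eq_bigr => b _.
    rewrite mulrCA; congr (_ * _); rewrite mulr_sumr; apply: eq_bigr => p _.
    rewrite (bigD1 g) //= big1 ?addr0 ?eqxx; first by rewrite mulr1; ring.
    by move=> q /negPf->; rewrite !mulr0.
  rewrite -pushA {1}/push mulr_sumr; apply: eq_bigr => a _.
  rewrite (bigD1 g) //= big1 ?addr0 ?eqxx.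
    under eq_push do rewrite mulr1.
    by rewrite subr0; ring.
  move=> q /negPf nqg; rewrite [push _ a]big1 ?mulr0 // => p _.
  by rewrite big1 // => ? _; rewrite nqg !mulr0.
rewrite rmul_cons2 bar_cons.
rewrite -[RHS]/(rmul (fun s => push (fun a b => F [:: a, b & s]) x -
               bar (fun s0 => F (x :: s0)) s) (y :: t)).
by rewrite rmulB rmul_push -IH.
Qed.

Lemma bnd_rmul F t : t != [::] -> bnd (rmul F) t = rmul (bnd F) t.
Proof.
case: t => // x t _; rewrite /bnd bar_rmul rmulB; congr (_ - _).
by rewrite rmul_lin.
Qed.

Lemma rmul_ends_in V F : (forall a y, V a -> ~~ V y -> k a g y = 0) ->
  ends_in V F -> ends_in V (rmul F).
Proof.
move=> Vg + a s; elim: s a F => [|b s IH] a F FV lV.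
  rewrite /= big1 // => x _.
  have [Vx|Vx] := boolP (V x); first by rewrite Vg // mulr0 mul0r.
  by rewrite FV // mulr0.
by rewrite rmul_cons2 IH // => ? ? ?; apply: FV.
Qed.

Lemma rmul_ends_in_ideal W F : left_ideal W -> W g -> ends_in W (rmul F).
Proof.
move=> idW Wg a s; elim: s a F => [|b s IH] a F lW; last by rewrite rmul_cons2 IH.
by rewrite /= big1 // => x _; rewrite (idW x g a) // mulr0 mul0r.
Qed.

Lemma rmul_id W F t : (forall x y, W x -> r * k x g y = (x == y)%:R) ->
  ends_in W F -> t != [::] -> rmul F t = F t.
Proof.
move=> Wg; elim: t F => // a [|b t] IH F FW _.
  rewrite /= (bigD1 a) //= big1 ?addr0 => [|x xa].
    have [Wa|Wa] := boolP (W a); first by rewrite Wg // eqxx mul1r.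
    by rewrite FW // mulr0.
  have [Wx|Wx] := boolP (W x); first by rewrite Wg // (negPf xa) mul0r.
  by rewrite FW // mulr0.
by rewrite rmul_cons2 IH // => ? ? ?; apply: FW.
Qed.

End RightMultiplication.

(* The quotient by the words ending in [V] has no homology in positive degrees. *)
Definition acyclic V := forall F,
  (forall a s, ~~ V (last a s) -> bnd F (a :: s) = 0) ->
  exists G, forall a b s, ~~ V (last b s) -> bnd G [:: a, b & s] = F [:: a, b & s].

(* The contracting homotopy for coefficients in the regular module, up to sign. *)
Definition append_one F (w : seq D) : R :=
  if w is a :: s then (last a s == one)%:R * F (belast a s) else 0.

(** Every face but the last commutes with appending [one]; the last face absorbs [one] and returns
    the original word, with the sign of its position. *)
Lemma bar_append_one F x t :
  bar (append_one F) (x :: t) = append_one (bar F) (x :: t) + (-1) ^+ size t * F (x :: t).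
Proof.
elim: t F x => [|y t IH] F x.
  rewrite /= subr0 mulr0 add0r mul1r /push.
  rewrite (bigD1 x) //= [X in _ + X]big1 ?addr0 => [|a ax].
    rewrite (bigD1 one) //= big1 ?addr0 => [|b nb1].
      by rewrite k1 !eqxx !mul1r.
    by rewrite (negPf nb1) mul0r mulr0.
  rewrite big1 // => b _; case: eqP => [->|]; last by rewrite mul0r mulr0.
  by rewrite k1 (negPf ax) mul0r.
rewrite bar_cons.
have -> : bar (fun s => append_one F (x :: s)) (y :: t) =
          bar (append_one (fun s => F (x :: s))) (y :: t).
  by apply: eq_bar => -[|? ?].
rewrite IH /= exprS.
have -> : push (fun a b => (last y t == one)%:R * F [:: a, b & belast y t]) x
  = (last y t == one)%:R * push (fun a b => F [:: a, b & belast y t]) x.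
  rewrite /push mulr_sumr; apply: eq_bigr => a _; rewrite mulr_sumr.
  by apply: eq_bigr => b _; ring.
ring.
Qed.

Lemma acyclic0 : acyclic pred0.
Proof.
(* The sign depending on the degree cancels the one produced by [bar_append_one]. *)
move=> F dF0; exists (fun w => - (-1) ^+ size w * append_one F w) => a b s _.
transitivity ((-1) ^+ size s * bnd (append_one F) [:: a, b & s]).
  by rewrite -bndZ; apply: eq_bnd => w /= ->; rewrite !exprS; ring.
rewrite /bnd bar_append_one.
have -> : \sum_x e x * append_one F [:: x, a, b & s] - (append_one (bar F) [:: a, b & s]
    + (-1) ^+ size (b :: s) * F [:: a, b & s]) =
   (last b s == one)%:R * bnd F (a :: belast b s)
     - (-1) ^+ size (b :: s) * F [:: a, b & s].
  rewrite /bnd mulrBr mulr_sumr opprD addrA; congr (_ - _ - _).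
  by apply: eq_bigr => x _; rewrite mulrCA.
rewrite dF0 // mulr0 sub0r /= exprS mulN1r mulNr opprK mulrA -expr2 -exprM mulnC.
by rewrite exprM sqrrN expr1n expr1n mul1r.
Qed.

(* [K], the span of [W] modulo that of [V], is also the span of [W] modulo that of [V'],
   onto which right multiplication by [r g] retracts the quotient by [V'].  In degree 0,
   [K] is acyclic since [1 (x) x = 1 (x) x (r g) = e x (x) (r g) = 0]. *)
Lemma acyclicU V V' W r g :
  left_ideal V -> left_ideal V' -> left_ideal W ->
  (forall x, W x -> V x = V' x) -> acyclic V -> acyclic V' ->
  W g -> (forall a y, V' a -> ~~ V' y -> k a g y = 0) ->
  (forall x y, W x -> r * k x g y = (x == y)%:R) ->
  (forall x, W x -> e x = 0) ->
  acyclic (predU V W).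
Proof.
move=> idV idV' idW eqV acV acV' Wg V'g gid eW F dF.
(* [k0] is the boundary of [F] as a chain of [K]: it is set to zero on words ending in [V], and it
   is supported on [W] because [F] is a cycle modulo [predU V W]. *)
pose k0 t := if t is a :: s then if V (last a s) then 0 else bnd F t else 0.
have k0W : ends_in W k0.
  move=> a s lW /=; case: ifP => // lV; apply: dF.
  by rewrite /= negb_or lV.
have dk0 a s : ~~ V' (last a s) -> bnd k0 (a :: s) = 0.
  move=> lV'; have [lW|lW] := boolP (W (last a s)); last first.
    exact: bnd_ends_in lW.
  have lV : ~~ V (last a s) by rewrite eqV.
  have kF : ends_in V (fun t => k0 t - bnd F t).
    by move=> b u /negPf lVu /=; rewrite lVu subrr.
  by have := bnd_ends_in idV kF lV; rewrite bndB bnd_bnd // subr0.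
(* [f] bounds [k0] modulo [V'], and [rmul] moves it into [W] while fixing [k0]. This works only on
   words of length at least two; [q] below measures the defect on single letters. *)
have [f df] := acV' k0 dk0; pose f' := rmul r g f.
have f'W : ends_in W f' by apply: rmul_ends_in_ideal.
have df' a b s : W (last b s) -> ~~ V' (last b s) ->
    bnd f' [:: a, b & s] = k0 [:: a, b & s].
  move=> lW lV'; rewrite bnd_rmul //.
  rewrite -[RHS](rmul_id gid k0W) //; apply/eqP; rewrite -subr_eq0 -rmulB; apply/eqP.
  (* The truncation discards single letters, about which [df] says nothing. *)
  pose h t := if (1 < size t)%N then bnd f t - k0 t else 0.
  have hV' : ends_in V' h.
    by move=> x [|y u] lVu //; rewrite /h [_ - _]/= df ?subrr.
  rewrite -[RHS](@rmul_ends_in r g V' h V'g hV' a (b :: s) lV').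
  by apply: eq_rmul => t /= st; rewrite /h st.
pose q x := k0 [:: x] - bnd f' [:: x].
have qW x : ~~ W x -> q x = 0.
  by move=> Wx; rewrite /q k0W // (bnd_ends_in idW) // subrr.
(* [f1] represents [q (x) r g]: its first face vanishes since [e] kills [W], and its last face gives
   back [q] since [r g] is a right identity on [W]. *)
pose f1 t := if t is [:: x; y] then (r * q x) * (y == g)%:R else 0.
have f1W : ends_in W f1.
  move=> x [|y [|]] //= Wy; case: eqP Wy => [->|_ _]; last by rewrite mulr0.
  by rewrite Wg.
have df1 y : bnd f1 [:: y] = - q y.
  rewrite /bnd big1 => [|x _]; last first.
    have [Wx|Wx] := boolP (W x); first by rewrite eW // mul0r.
    by rewrite /= qW // mulr0 mul0r mulr0.
  rewrite sub0r /= subr0; congr (- _).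
  transitivity (\sum_x (r * k x g y) * q x).
    apply: eq_bigr => x _; rewrite (bigD1 g) //= big1 ?addr0 ?eqxx => [|z /negPf->].
      by rewrite mulr1; ring.
    by rewrite !mulr0.
  rewrite (bigD1 y) //= big1 ?addr0 => [|x xy].
    have [Wy|Wy] := boolP (W y); first by rewrite gid // eqxx mul1r.
    by rewrite qW // mulr0.
  have [Wx|Wx] := boolP (W x); first by rewrite gid // (negPf xy) mul0r.
  by rewrite qW // mulr0.
have df1' a b s : bnd f1 [:: a, b & s] = 0.
  rewrite -[RHS](mul0r (bnd f1 [:: a, b & s])) -bndZ; apply: eq_bnd => t.
  by case: t => [|? [|? [|? ?]]] //= _; rewrite mul0r.
have dK a s : ~~ V (last a s) -> bnd (fun t => f' t - f1 t) (a :: s) = bnd F (a :: s).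
  have [lW|lW] := boolP (W (last a s)) => lV; last first.
    rewrite dF /=; last by rewrite negb_or lV.
    by apply: (bnd_ends_in idW) => // b u Wu; rewrite f'W // f1W // subrr.
  rewrite -[RHS]/(if false then 0 else bnd F (a :: s)) -(negbTE lV) -/(k0 (a :: s)).
  rewrite bndB; case: s lW lV => [|b s] lW lV.
    by rewrite df1 /q; ring.
  by rewrite df1' subr0 df' // -eqV.
(* Subtracting a chain of [W] makes [F] a cycle modulo [V] and changes nothing modulo
   [predU V W]. *)
have /acV[G dG] a s : ~~ V (last a s) -> bnd (fun t => F t - (f' t - f1 t)) (a :: s) = 0.
  by move=> lV; rewrite bndB dK // subrr.
exists G => a b s; rewrite /= negb_or => /andP[lV lW].
by rewrite dG // f'W // f1W // !subr0.
Qed.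

End BarComplex.

(** * Algebras in which the product of two basis elements is a multiple of a basis element *)

Section Monomial.
Variables (R : comPzRingType) (D : finType) (m : D -> D -> D) (c : D -> D -> R).
Implicit Types (t w : seq D) (F : seq D -> R).

Definition monomial_const a b x : R := if m a b == x then c a b else 0.

Local Notation k := monomial_const.

Lemma sum_monomial_const a b (h : D -> R) : \sum_x k a b x * h x = c a b * h (m a b).
Proof.
rewrite (bigD1 (m a b)) //= big1 ?addr0 => [|x]; first by rewrite /k eqxx.
by rewrite /k eq_sym => /negPf->; rewrite mul0r.
Qed.

Lemma monomial_constA :
  associative m -> (forall a b d, c a b * c (m a b) d = c b d * c a (m b d)) ->
  forall a b d x, \sum_y k a b y * k y d x = \sum_y k b d y * k a y x.
Proof.
move=> mA cA a b d x; rewrite !sum_monomial_const /k mA.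
by case: ifP; rewrite ?mulr0.
Qed.

(** Translates the recursive [bar], which computes coefficients, into the usual alternating list of
    faces of a single word. *)
Lemma bar_indicator (x0 : D) w t :
  bar k (fun s => (s == w)%:R) t =
  \sum_(i < (size w).-1)
    (-1) ^+ i * c (nth x0 w i) (nth x0 w i.+1) *
      (take i w ++ m (nth x0 w i) (nth x0 w i.+1) :: drop i.+2 w == t)%:R.
Proof.
elim: t w => [|x t IH] w /=.
  by rewrite big1 // => i _; rewrite -size_eq0 size_cat addnS mulr0.
have P w' : size w' != (size t).+2 ->
    push k (fun a b => ([:: a, b & t] == w')%:R) x = 0.
  move=> sw; rewrite /push big1 // => a _; rewrite big1 // => b _.
  by rewrite (_ : (_ == w') = false) ?mulr0 //; apply: contraNF sw => /eqP<-.
case: w => [|a w].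
  rewrite P // sub0r big_ord0 -[RHS]oppr0; congr (- _).
  rewrite -[RHS](mul0r (bar k (fun=> 0) t)) -barZ.
  by apply: eq_bar => s _; rewrite mul0r.
have -> : bar k (fun s => (x :: s == a :: w)%:R) t =
          (x == a)%:R * bar k (fun s => (s == w)%:R) t.
  by rewrite -barZ; apply: eq_bar => s _; rewrite eqseq_cons -mulnb natrM.
rewrite IH /=; case: w => [|b w] /=.
  by rewrite !big_ord0 mulr0 subr0 P.
rewrite big_ord_recl /= mul1r drop0; congr (_ + _).
  rewrite /push (bigD1 a) //= [X in _ + X]big1 ?addr0 => [|a' a'a].
    rewrite (bigD1 b) //= [X in _ + X]big1 ?addr0 => [|b' b'b].
      rewrite !eqseq_cons !eqxx /= /k [t == w]eq_sym -mulnb natrM mulrA.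
      by case: (_ == x); rewrite /= ?mulr1 // mulr0 mul0r.
    by rewrite !eqseq_cons (negPf b'b) andbF mulr0.
  by rewrite big1 // => b' _; rewrite !eqseq_cons (negPf a'a) mulr0.
rewrite mulr_sumr -sumrN; apply: eq_bigr => i _.
rewrite eqseq_cons [x == a]eq_sym -mulnb natrM exprS; ring.
Qed.

End Monomial.

(** * Diagrams as relations between 2-colourings *)

Section DiagramRelations.
Variable n : nat.
Local Notation D := (diagram n).
Implicit Types (a b d : D) (p q : pt n).

Lemma same_blockE d p q : same_block d p q = (q \in pblock (val d) p).
Proof.
have /and3P[/eqP cov tI _] := valP d.
apply/existsP/idP => [[A /and3P[Ad pA qA]]|qp].
  by rewrite (def_pblock tI Ad pA).
exists (pblock (val d) p); rewrite qp pblock_mem ?cov ?inE //=.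
by rewrite mem_pblock cov inE.
Qed.

Lemma same_block_refl d : reflexive (same_block d).
Proof. by move=> p; rewrite same_blockE mem_pblock (cover_partition (valP d)) inE. Qed.

Lemma same_blockP d : equivalence_rel (same_block d).
Proof.
have /and3P[/eqP cov tI _] := valP d.
move=> p q r; split; first exact: same_block_refl.
by rewrite !same_blockE => pq; rewrite -(same_pblock tI pq).
Qed.

Lemma same_block_sym d : symmetric (same_block d).
Proof.
move=> p q; apply/idP/idP => H.
  by have [_ /(_ H)<-] := same_blockP d p q p; apply: same_block_refl.
by have [_ /(_ H)<-] := same_blockP d q p q; apply: same_block_refl.
Qed.

Lemma same_block_trans d : transitive (same_block d).
Proof. by move=> q p r pq; have [_ /(_ pq)<-] := same_blockP d p q r. Qed.

Lemma diagram_ext a b : same_block a =2 same_block b -> a = b.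
Proof.
move=> eqab; apply: val_inj.
rewrite -(equivalence_partition_pblock (valP a)).
rewrite -[RHS](equivalence_partition_pblock (valP b)).
apply: eq_imset => p; apply/setP => q; rewrite !inE -!same_blockE; exact: eqab.
Qed.

Lemma same_block_eqrel (E : rel (pt n)) d : equivalence_rel E ->
  val d = equivalence_partition E [set: pt n] -> same_block d =2 E.
Proof.
move=> eqE vd p q; rewrite same_blockE vd.
by rewrite pblock_equivalence_partition ?inE // => ? ? ? _ _ _; apply: eqE.
Qed.

Lemma block_pblock d (A : {set pt n}) p :
  A \in val d -> p \in A -> A = [set q | same_block d p q].
Proof.
have /and3P[_ tI _] := valP d.
move=> Ad pA; rewrite -{1}(def_pblock tI Ad pA).
by apply/setP => q; rewrite inE same_blockE.
Qed.

Lemma block_mem d p : [set q | same_block d p q] \in val d.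
Proof.
have /and3P[/eqP cov tI _] := valP d.
rewrite (_ : [set q | _] = pblock (val d) p).
  by rewrite pblock_mem // cov inE.
by apply/setP => q; rewrite inE same_blockE.
Qed.

Lemma cedge_sym a b : symmetric (cedge a b).
Proof.
move=> x y; rewrite /cedge (same_block_sym a) (same_block_sym b).
by congr (_ || _); rewrite andbCA.
Qed.

Lemma connect_cedge_equiv a b : equivalence_rel (connect (cedge a b)).
Proof.
move=> x y z; split; first exact: connect0.
have sc := sym_connect_sym (cedge_sym a b).
by move=> xy; apply/(same_connect sc).
Qed.

(** Connectivity is an equivalence relation, so [compose_set] is a partition and [insubd] does not
    fall back on its default. *)
Lemma same_block_dcomp a b p q :
  same_block (dcomp a b) p q = connect (cedge a b) (outer p) (outer q).
Proof.
pose E : rel (pt n) := fun p q => connect (cedge a b) (outer p) (outer q).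
have eqE : equivalence_rel E by move=> x y z; apply: connect_cedge_equiv.
have cE : compose_set a b = equivalence_partition E [set: pt n].
  apply/setP => A; apply/imsetP/imsetP => -[x _ ->]; exists x; rewrite ?inE //;
    by apply/setP => y; rewrite !inE.
apply: (same_block_eqrel (E := E)) => //.
rewrite -cE /dcomp insubdK // unfold_in cE.
by apply: equivalence_partitionP => ? ? ? _ _ _; apply: eqE.
Qed.

Definition colouring := {ffun 'I_n -> bool}.
Implicit Types (u v w : colouring).

Definition glue u v p := if p.1 then v p.2 else u p.2.

Definition compat d u v :=
  [forall p, forall q, same_block d p q ==> (glue u v p == glue u v q)].

Lemma compatP d u v :
  reflect (forall p q, same_block d p q -> glue u v p = glue u v q) (compat d u v).
Proof.
apply: (iffP forallP) => [H p q pq|H p].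
  by have /forallP/(_ q)/implyP/(_ pq)/eqP := H p.
by apply/forallP => q; apply/implyP => pq; rewrite (H p q).
Qed.

Definition restr (z : pt n -> bool) (s : bool) : colouring := [ffun i => z (s, i)].

Lemma glue_restr z p : glue (restr z false) (restr z true) p = z p.
Proof. by case: p => -[] i; rewrite /glue /= ffunE. Qed.

(** The indicator of the block of [p] is itself a compatible colouring and separates [p] from every
    node outside the block. *)
Lemma same_block_compat d p q :
  reflect (forall u v, compat d u v -> glue u v p = glue u v q) (same_block d p q).
Proof.
apply: (iffP idP) => [pq u v /compatP|H]; first exact.
have := H (restr (same_block d p) false) (restr (same_block d p) true).
rewrite !glue_restr same_block_refl => <- //.
apply/compatP => x y xy; rewrite !glue_restr.
by apply/idP/idP => /same_block_trans; apply=> //; rewrite same_block_sym.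
Qed.

Lemma compat_ext a b : compat a =2 compat b -> a = b.
Proof.
move=> eqab; apply: diagram_ext => p q.
by apply/same_block_compat/same_block_compat => H u v;
  [rewrite -eqab | rewrite eqab]; apply: H.
Qed.

Lemma compat_const d (c : bool) : compat d [ffun=> c] [ffun=> c].
Proof. by apply/compatP => -[[] i] [[] j] _; rewrite /glue /= !ffunE. Qed.

Definition glue3 u v w (x : cpt n) : bool :=
  if (x.1 == 0 :> nat)%N then u x.2 else if (x.1 == 1 :> nat)%N then v x.2 else w x.2.

Lemma compat2P a b u v w :
  reflect (forall x y, connect (cedge a b) x y -> glue3 u v w x = glue3 u v w y)
          (compat a u v && compat b v w).
Proof.
apply: (iffP andP) => [[/compatP cua /compatP cvb] x y|H].
  case/connectP => t; elim: t x => [|z t IH] x /=; first by move=> _ ->.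
  case/andP => xz pz lz; rewrite -(IH z) // => {pz lz IH}.
  move: xz; case: x z => -[[|[|[|//]]] ?] i -[[[|[|[|//]]] ?] j];
    rewrite /cedge /glue3 /= ?orbF ?andbF //.
  - by move/cua.
  - by move/cua.
  - by move/cua.
  - by case/orP => [/cua|/cvb].
  - by move/cvb.
  - by move/cvb.
  - by move/cvb.
(* [l1] and [l2] place the two sides of [a] and of [b] in the stack of three rows, so that each pair
   in a block becomes an edge. *)
pose l1 (s : bool) : 'I_3 := if s then inord 1 else inord 0.
pose l2 (s : bool) : 'I_3 := if s then inord 2 else inord 1.
split; apply/compatP => -[s i] [s' j] ij.
  have := H (l1 s, i) (l1 s', j); rewrite /glue3 /glue.
  case: s s' ij => -[] ij; rewrite /= !inordK //=; apply;
    by apply: connect1; rewrite /cedge /= !inordK //= ij.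
have := H (l2 s, i) (l2 s', j); rewrite /glue3 /glue.
case: s s' ij => -[] ij; rewrite /= !inordK //=; apply;
  by apply: connect1; rewrite /cedge /= !inordK //= ij ?orbT.
Qed.


(** * Counting the colourings of the middle row *)

Section Middle.
Variables a b : D.
Local Notation conn := (connect (cedge a b)).

Definition middle (i : 'I_n) : cpt n := (inord 1, i).

Definition middle_comps : {set {set cpt n}} :=
  [set [set y | conn x y] | x : cpt n &
    ((x.1 : nat) == 1%N) && [forall p, ~~ conn x (outer p)]].

Lemma middleE (x : cpt n) : (x.1 : nat) == 1%N -> x = middle x.2.
Proof.
by case: x => x i /= /eqP x1; congr (_, _); apply: val_inj; rewrite /= inordK.
Qed.

Lemma glue3_outer u v w p : glue3 u v w (outer p) = glue u w p.
Proof. by case: p => -[]. Qed.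

Lemma glue3_middle u v w i : glue3 u v w (middle i) = v i.
Proof. by rewrite /glue3 /= inordK. Qed.

(** The outer node picked is immaterial once [u] and [w] are compatible with the product; [S] is the
    set of middle components coloured [true]. *)
Definition fill u w (S : {set {set cpt n}}) (x : cpt n) : bool :=
  if [pick p | conn x (outer p)] is Some p then glue u w p
  else [set y | conn x y] \in S.

Lemma fill_conn u w S x y : conn x y -> fill u w S x = fill u w S y.
Proof.
move=> xy; have eqc := same_connect (sym_connect_sym (cedge_sym a b)) xy.
rewrite /fill (eq_pick (Q := fun p => conn y (outer p))) => [|p]; last exact: eqc.
by case: pickP => // _; congr (_ \in S); apply/setP => z; rewrite !inE eqc.
Qed.

Definition fill_middle u w S : colouring := [ffun i => fill u w S (middle i)].

Lemma compat_fill u w S : compat (dcomp a b) u w ->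
  compat a u (fill_middle u w S) && compat b (fill_middle u w S) w.
Proof.
move=> /compatP cuw; apply/compat2P => x y /fill_conn E.
suff {x y E} H x : glue3 u (fill_middle u w S) w x = fill u w S x by rewrite !H.
have Ho p : glue u w p = fill u w S (outer p).
  rewrite /fill; case: pickP => [q pq|/(_ p)]; last by rewrite connect0.
  by apply: cuw; rewrite same_block_dcomp.
have [x1|x1] := boolP ((x.1 : nat) == 1%N).
  by rewrite (middleE x1) glue3_middle ffunE.
have -> : x = outer ((x.1 : nat) == 2, x.2).
  case: x x1 => -[[|[|[|//]]] ?] i //= _; congr (_, _); exact: val_inj.
by rewrite glue3_outer Ho.
Qed.

(** The outer colours force the colour of each component reaching an outer row, and each middle
    component is coloured freely, so [fill_middle] is a bijection from the subsets of
    [middle_comps]. *)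
Lemma card_compat u w :
  #|[set v | compat a u v && compat b v w]| =
  if compat (dcomp a b) u w then (2 ^ nmid a b)%N else 0%N.
Proof.
case: ifP => [cuw|/negP cuw]; last first.
  apply: eq_card0 => v; rewrite inE; apply/negP => /compat2P H; apply: cuw.
  apply/compatP => p q; rewrite same_block_dcomp => /H.
  by rewrite !glue3_outer.
rewrite -[nmid a b]/#|middle_comps| -card_powerset.
have inj_fill : {in powerset middle_comps &, injective (fill_middle u w)}.
  have sub (S S' : {set {set cpt n}}) A : S \subset middle_comps ->
      fill_middle u w S = fill_middle u w S' -> A \in S -> A \in S'.
    move=> /subsetP sS eqS AS.
    have /imsetP[x /[!inE] /andP[x1 /forallP nx] Ax] := sS A AS.
    move/ffunP/(_ x.2): eqS; rewrite !ffunE -middleE // /fill.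
    case: pickP => [p xp|_]; first by have := nx p; rewrite xp.
    by rewrite -Ax AS => <-.
  move=> S S'; rewrite !inE => sS sS' eqS; apply/setP => A.
  by apply/idP/idP; [apply: sub eqS | apply: sub (esym eqS)].
rewrite -(card_in_imset inj_fill); apply: eq_card => v; rewrite inE.
apply/idP/imsetP => [/compat2P H|[S _ ->]]; last exact: compat_fill.
exists [set A in middle_comps | [exists i, (middle i \in A) && v i]].
  by rewrite inE; apply/subsetP => A; rewrite inE => /andP[].
apply/ffunP => i; rewrite ffunE /fill.
case: pickP => [p ip|ni]; first by have := H _ _ ip; rewrite glue3_middle glue3_outer.
rewrite inE; have -> : [set y | conn (middle i) y] \in middle_comps.
  apply/imsetP; exists (middle i) => //; rewrite inE /= inordK //=.
  by apply/forallP => p; rewrite ni.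
apply/idP/existsP => [vi|[j /andP[]]]; first by exists i; rewrite inE connect0.
by rewrite inE => /H; rewrite !glue3_middle => ->.
Qed.

Lemma compat_dcomp u w :
  reflect (exists2 v, compat a u v & compat b v w) (compat (dcomp a b) u w).
Proof.
have := card_compat u w; case: (compat (dcomp a b) u w) => c; constructor.
  have /card_gt0P[v] : (0 < #|[set v | compat a u v && compat b v w]|)%N.
    by rewrite c expn_gt0.
  by rewrite inE => /andP[]; exists v.
case=> v uv vw; move/eqP: c; rewrite cards_eq0 => /eqP/setP/(_ v).
by rewrite !inE uv vw.
Qed.

End Middle.

Lemma compat_pair a b u w v :
  compat a u v -> compat b v w -> compat (dcomp a b) u w.
Proof. by move=> uv vw; apply/compat_dcomp; exists v. Qed.

Lemma dcompA a b d : dcomp a (dcomp b d) = dcomp (dcomp a b) d.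
Proof.
apply: compat_ext => u w; apply/compat_dcomp/compat_dcomp.
  by case=> v uv /compat_dcomp[v' vv' v'w]; exists v' => //; apply: compat_pair vv'.
by case=> v /compat_dcomp[v' uv' v'v] vw; exists v' => //; apply: compat_pair vw.
Qed.

Lemma card_pred_sum (T : finType) (P : pred T) : #|[set v | P v]| = (\sum_v P v)%N.
Proof. by rewrite -sum1dep_card big_mkcond; apply: eq_bigr => v _; case: (P v). Qed.

Lemma nmid_count a b (u w : colouring) : compat (dcomp a b) u w ->
  (2 ^ nmid a b = \sum_v (compat a u v && compat b v w))%N.
Proof. by rewrite -card_pred_sum card_compat => ->. Qed.

(** With both outer rows coloured [z], both sides are exponents of 2 counting the pairs of
    colourings of the two inner rows of a triple stack. *)
Lemma nmidA a b d :
  (nmid a b + nmid (dcomp a b) d = nmid b d + nmid a (dcomp b d))%N.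
Proof.
apply/eqP; rewrite -(eqn_exp2l (m := 2)) // !expnD; apply/eqP.
pose z : colouring := [ffun=> false].
have count x y u w : (2 ^ nmid x y * compat (dcomp x y) u w =
    \sum_v (compat x u v && compat y v w))%N.
  rewrite -card_pred_sum card_compat.
  by case: ifP; rewrite ?muln1 ?muln0.
rewrite mulnC (nmid_count (compat_const (dcomp (dcomp a b) d) false)) -/z big_distrl /=.
rewrite [RHS]mulnC (nmid_count (compat_const (dcomp a (dcomp b d)) false)) -/z.
rewrite [RHS]big_distrl /=.
under eq_bigr do rewrite mulnC -mulnb mulnA count big_distrl /=.
under [RHS]eq_bigr do rewrite mulnC -mulnb mulnCA count big_distrr /=.
rewrite exchange_big; apply: eq_bigr => v _; apply: eq_bigr => v' _.
by rewrite -!mulnb mulnA.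
Qed.

(** * Permutation diagrams as total relations with trivial kernel *)

Section Permutations.
Implicit Types (s : bool) (z : colouring).

(* [z] on side [s], [z'] on the other side *)
Definition scompat s d z z' := if s then compat d z' z else compat d z z'.

Lemma scompatP s d z z' :
  reflect (forall p q, same_block d p q ->
    (if p.1 == s then z p.2 else z' p.2) = (if q.1 == s then z q.2 else z' q.2))
  (scompat s d z z').
Proof.
by rewrite /scompat; case: s; apply: (iffP (compatP _ _ _)) => H p q /H;
  rewrite /glue; case: p q => [] [] i [] [] j.
Qed.

Lemma scompat_restr s d (z : pt n -> bool) :
  (forall p q, same_block d p q -> z p = z q) ->
  scompat s d (restr z s) (restr z (~~ s)).
Proof.
move=> zd; apply/scompatP => -[t i] [t' j] /zd.
by rewrite !ffunE /=; case: s t t' => -[] [].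
Qed.

Definition separated s d := forall i j, same_block d (s, i) (s, j) -> i = j.
Definition linked s d := forall i, exists j, same_block d (s, i) (~~ s, j).

(** Colouring each block by its only node on side [s], if any, extends [z]; conversely the indicator
    of [i] extends only if no other node of that side shares its block. *)
Lemma separatedP s d : separated s d <-> forall z, exists z', scompat s d z z'.
Proof.
split=> [sep z|tot i j ij].
  pose c p := if [pick i | same_block d (s, i) p] is Some i then z i else false.
  have zE : z = restr c s.
    apply/ffunP => i; rewrite ffunE /c.
    by case: pickP => [j /sep->//|/(_ i)]; rewrite same_block_refl.
  exists (restr c (~~ s)); rewrite {1}zE; apply: scompat_restr => p q pq.
  rewrite /c (eq_pick (Q := fun i => same_block d (s, i) q)) // => i.
  by apply/idP/idP => /same_block_trans; apply; rewrite // same_block_sym.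
have [z' /scompatP/(_ _ _ ij)] := tot [ffun k => k == i].
by rewrite !eqxx !ffunE eqxx => /esym/eqP.
Qed.

Lemma linkedP s d :
  linked s d <-> forall z, scompat s d z [ffun=> false] -> z = [ffun=> false].
Proof.
split=> [lnk z /scompatP zd|inj i].
  apply/ffunP => i; have [j /zd] := lnk i.
  by case: s {zd lnk} => /=; rewrite !ffunE.
apply/existsP/contraT => /existsPn no.
have c0 : restr (same_block d (s, i)) (~~ s) = [ffun=> false].
  by apply/ffunP => j; rewrite !ffunE; apply/negbTE.
have /inj/ffunP/(_ i) : scompat s d (restr (same_block d (s, i)) s) [ffun=> false].
  rewrite -c0; apply: scompat_restr => p q pq.
  by apply/idP/idP => /same_block_trans; apply; rewrite // same_block_sym.
by rewrite !ffunE same_block_refl.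
Qed.

(** If [d] is separated and linked on one side, choosing partners gives an injection [f] of a finite
    set, hence a bijection, and every block is a node with its partner. *)
Lemma is_permP s d : reflect (separated s d /\ linked s d) (is_perm d).
Proof.
apply: (iffP forallP) => [perm|[sep lnk] A].
  have H t i : exists k : 'I_n,
      forall p, same_block d (t, i) p = (p \in [:: (t, i); (~~ t, k)]).
    have /implyP/(_ (block_mem d (t, i))) := perm [set p | same_block d (t, i) p].
    case/existsP => k /existsP[l /eqP kl].
    have E p : same_block d (t, i) p = (p == (false, k)) || (p == (true, l)).
      by have /setP/(_ p) := kl; rewrite !inE.
    have := E (t, i); rewrite same_block_refl => /esym/orP[]/eqP[tE iE]; subst t i.
      by exists l => p; rewrite E !inE.
    by exists k => p; rewrite E !inE orbC.
  split=> [i j|i].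
    have [k ->] := H s i; rewrite !inE => /orP[] /eqP[] //.
    by case: s.
  by have [k E] := H s i; exists k; rewrite E !inE eqxx orbT.
apply/implyP => Ad.
have {}lnk i : {j | same_block d (s, i) (~~ s, j)} by apply/sigW/lnk.
pose f i := sval (lnk i).
have fi i : same_block d (s, i) (~~ s, f i) := svalP (lnk i).
have inj_f : injective f.
  move=> i j fij; apply: sep; apply: same_block_trans (fi i) _.
  by rewrite fij same_block_sym.
have [g fK gK] := injF_bij inj_f.
have [p pA] : exists p, p \in A.
  apply/set0Pn; have /and3P[_ _ /negP n0] := valP d.
  by apply/eqP => A0; rewrite -A0 in n0.
have [i iA] : exists i, (s, i) \in A.
  rewrite (block_pblock Ad pA); case: p {pA} => t i.
  have [->|ts] := eqVneq t s; first by exists i; rewrite inE same_block_refl.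
  have -> : t = ~~ s by move: ts; case: (t); case: (s).
  by exists (g i); rewrite inE same_block_sym -{2}(gK i).
have -> : A = [set (s, i); (~~ s, f i)].
  rewrite (block_pblock Ad iA); apply/setP => -[t j]; rewrite !inE.
  have [->|ts] := eqVneq t s.
    apply/idP/orP => [/sep->|[/eqP[->]|/eqP[]]]; rewrite ?same_block_refl //.
      by left.
    by case: (s).
  have -> : t = ~~ s by move: ts; case: (t); case: (s).
  apply/idP/orP => [ij|[/eqP[]|/eqP[->]]]; rewrite ?fi //; last by case: (s).
  right; apply/eqP; congr (_, _).
  rewrite -(gK j); congr f; apply/esym/sep; apply: same_block_trans ij _.
  by rewrite same_block_sym -{2}(gK j).
case: s {sep lnk f fi inj_f g fK gK iA} (f i) => k.
  by apply/existsP; exists k; apply/existsP; exists i; rewrite setUC.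
by apply/existsP; exists i; apply/existsP; exists k.
Qed.

(** Totality and trivial kernel pass to composites; conversely they pass from the composite to [a]
    when read from the left and to [b] when read from the right. *)
Lemma is_perm_dcomp a b : is_perm (dcomp a b) = is_perm a && is_perm b.
Proof.
pose z : colouring := [ffun=> false].
apply/idP/andP => [pab|[/(is_permP false)[/separatedP sa /linkedP la]]].
  split; [apply/(is_permP false) | apply/(is_permP true)].
    have /(is_permP false)[/separatedP sab /linkedP lab] := pab.
    split; [apply/separatedP => u | apply/linkedP => u uz].
      by have [w /compat_dcomp[v uv _]] := sab u; exists v.
    by apply: lab; apply: compat_pair uz _; apply: compat_const.
  have /(is_permP true)[/separatedP sab /linkedP lab] := pab.
  split; [apply/separatedP => u | apply/linkedP => u uz].
    by have [w /compat_dcomp[v _ uv]] := sab u; exists v.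
  by apply: lab; apply: compat_pair _ uz; apply: compat_const.
move=> /(is_permP false)[/separatedP sb /linkedP lb].
apply/(is_permP false); split; [apply/separatedP => u | apply/linkedP => u].
  have [v uv] := sa u; have [w vw] := sb v.
  by exists w; apply: compat_pair uv vw.
by move=> /compat_dcomp[v uv /lb vz]; apply: la; rewrite -vz.
Qed.

Lemma nmid_perml a b : is_perm a -> nmid a b = 0%N.
Proof.
move=> /(is_permP true)[_ /linkedP la]; apply/eqP; rewrite -(eqn_exp2l (m := 2)) //.
rewrite (nmid_count (compat_const (dcomp a b) false)); apply/eqP.
rewrite (bigD1 [ffun=> false]) //= !compat_const big1 // => v.
by case E: (compat a _ v) => // /eqP[]; apply: la.
Qed.

End Permutations.
End DiagramRelations.

(** * Constraints on right nodes *)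

Section DiagramConstraints.
Variable n : nat.
Local Notation D := (diagram n).
Local Notation colouring := (colouring n).
Implicit Types (a b d : D) (p q : pt n).
Implicit Types (u v w : colouring).

(** * The identity diagram and the diagrams used for the retractions *)

Section KernelDiagrams.

Definition kernel_diagram (T : eqType) (h : pt n -> T) : D :=
  Sub (preim_partition h [set: pt n]) (preim_partitionP h _).

Lemma compat_kernelP (T : eqType) (h : pt n -> T) (u v : colouring) :
  reflect (forall p q, h p = h q -> glue u v p = glue u v q)
    (compat (kernel_diagram h) u v).
Proof.
have E : same_block (kernel_diagram h) =2 (fun p q => h p == h q).
  apply: same_block_eqrel => // p q r; split; [exact: eqxx | by move/eqP->].
apply: (iffP (compatP _ _ _)) => H p q; first by move/eqP; rewrite -E; apply: H.
by rewrite E => /eqP; apply: H.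
Qed.

Definition id_diagram := kernel_diagram (fun p => p.2).

Lemma compat_id (u v : colouring) : compat id_diagram u v = (u == v).
Proof.
apply/compat_kernelP/eqP => [H|-> [s i] [t j] /= ->].
  by apply/ffunP => i; apply: (H (false, i) (true, i)).
by case: s t => -[].
Qed.

Lemma dcomp_id d : dcomp d id_diagram = d.
Proof.
apply: compat_ext => u v; apply/compat_dcomp/idP => [[w uw]|uv].
  by rewrite compat_id => /eqP<-.
by exists v; rewrite ?compat_id.
Qed.

(** Over the constant colouring the middle row has a single colouring, and 1 is 2 to the power 0. *)
Lemma nmid_functional d g :
  (forall v v' w, compat g v w -> compat g v' w -> v = v') -> nmid d g = 0%N.
Proof.
move=> fun_g; apply/eqP; rewrite -(eqn_exp2l (m := 2)) //.
rewrite (nmid_count (compat_const _ false)); apply/eqP.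
rewrite (bigD1 [ffun=> false]) //= !compat_const big1 // => v.
case E: (compat g v _) => /eqP vz; last by rewrite andbF.
by case: vz; apply: fun_g E _; apply: compat_const.
Qed.

Lemma nmid_id d : nmid d id_diagram = 0%N.
Proof.
by apply: nmid_functional => v v' w; rewrite !compat_id => /eqP-> /eqP->.
Qed.

Definition fuse x y := kernel_diagram (fun p : pt n => if p.2 == y then x else p.2).

Lemma compat_fuse x y (u v : colouring) :
  compat (fuse x y) u v = (u == v) && (u x == u y).
Proof.
apply/compat_kernelP/andP => [H|[/eqP<- /eqP uxy] [s i] [t j]].
  split; last by apply/eqP/(H (false, x) (false, y)); rewrite /= eqxx if_same.
  by apply/eqP/ffunP => i; apply: (H (false, i) (true, i)).
rewrite /glue !if_same /=.
by case: (eqVneq i y) (eqVneq j y) => [->|_] [->|_] // => [<-|->|->].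
Qed.

(* right node [x] is a singleton, left node [x] joins the strand of [z] *)
Definition detach x z :=
  kernel_diagram (fun p : pt n => if p == (false, x) then z else p.2).

Lemma compat_detach x z (u v : colouring) : x != z ->
  compat (detach x z) u v = (u x == u z) && [forall i, (i != x) ==> (u i == v i)].
Proof.
move=> xz; apply/compat_kernelP/andP => [H|[/eqP uxz /forallP uv] [s i] [t j]].
  split; first apply/eqP/(H (false, x) (false, z)).
    by rewrite eqxx xpair_eqE [z == x]eq_sym (negPf xz).
  apply/forallP => i; apply/implyP => ix.
  by apply/eqP/(H (false, i) (true, i)); rewrite !xpair_eqE (negPf ix).
have {}uv k : k != x -> u k = v k by move=> kx; apply/eqP; exact: (implyP (uv k)).
rewrite /glue !xpair_eqE /=; case: s t => -[] /=.
- by move->.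
- case: (eqVneq j x) => [->|jx] /= ->; first by rewrite uxz uv // eq_sym.
  by rewrite uv.
- case: (eqVneq i x) => [->|ix] /= <-; first by rewrite uxz uv // eq_sym.
  by rewrite uv.
- by case: (eqVneq i x) (eqVneq j x) => [->|_] [->|_] //= => [<-|->|->].
Qed.

(* both copies of [x] are singletons *)
Definition cut x :=
  kernel_diagram (fun p : pt n => if p == (true, x) then None else Some p.2).

Lemma compat_cut x (u v : colouring) :
  compat (cut x) u v = [forall i, (i != x) ==> (u i == v i)].
Proof.
apply/compat_kernelP/forallP => [H i|uv [s i] [t j]].
  apply/implyP => ix.
  by apply/eqP/(H (false, i) (true, i)); rewrite !xpair_eqE (negPf ix).
have {}uv k : k != x -> u k = v k by move=> kx; apply/eqP; exact: (implyP (uv k)).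
rewrite /glue !xpair_eqE /=; case: s t => -[] /=.
- by case: (eqVneq i x) (eqVneq j x) => [->|_] [->|_] //= [->].
- by case: (eqVneq i x) => [->|ix] //= [<-]; rewrite uv.
- by case: (eqVneq j x) => [->|ix] //= [->]; rewrite uv.
- by case=> ->.
Qed.

End KernelDiagrams.

(** * Violators of a constraint, and right multiplications fixing them *)

Section Constraints.
Implicit Types (x y z : 'I_n) (c : 'I_n * 'I_n) (C : {set 'I_n * 'I_n}).

(* Diagonal pairs encode the condition that a right node is a singleton block. *)
Definition viol c d : bool :=
  if c.1 == c.2 then [set ((true, c.1) : pt n)] \in val d
  else same_block d (true, c.1) (true, c.2).

Definition violates C : pred D := fun d => [exists c in C, viol c d].

Lemma inJE (X : {set 'I_n}) d : inJ X d = violates (setX X X) d.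
Proof.
apply/orP/existsP => [[/existsP[x /andP[xX dx]]|/existsP[x /andP[xX /existsP[y]]]]|].
- by exists (x, x); rewrite in_setX xX /viol eqxx.
- case/and3P => yX xy dxy; exists (x, y).
  by rewrite in_setX xX yX /viol /= (negPf xy).
case=> -[x y]; rewrite in_setX /viol /= => /andP[/andP[xX yX]].
case: (eqVneq x y) => [_ dx|xy dxy]; [left | right].
  by apply/existsP; exists x; rewrite xX.
by apply/existsP; exists x; rewrite xX; apply/existsP; exists y; rewrite yX xy.
Qed.

Lemma viol_pairP x y d : x != y ->
  reflect (forall u v, compat d u v -> v x = v y) (viol (x, y) d).
Proof.
move=> xy; rewrite /viol /= (negPf xy).
by apply: (iffP (same_block_compat _ _ _)) => H u v /H.
Qed.

Lemma singletonP d p :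
  reflect (forall q, same_block d p q -> q = p) ([set p] \in val d).
Proof.
apply: (iffP idP) => [pd q|H].
  have := block_pblock pd (set11 p) => /setP/(_ q).
  by rewrite !inE => <- /eqP.
rewrite (_ : [set p] = [set q | same_block d p q]) ?block_mem //.
apply/setP => q; rewrite !inE; apply/eqP/idP => [->|/H//].
exact: same_block_refl.
Qed.

(** A right node is a singleton exactly when its colour can be changed alone. *)
Lemma viol_singleP x d :
  reflect (forall u v v', compat d u v -> (forall i, i != x -> v i = v' i) ->
             compat d u v')
    (viol (x, x) d).
Proof.
rewrite /viol eqxx /=; apply: (iffP (singletonP _ _)) => [H u v v'|H q xq].
  move=> /compatP uv vv'; apply/compatP => p q pq.
  have [px|px] := eqVneq p (true, x); first by rewrite px in pq *; rewrite (H q).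
  have [qx|qx] := eqVneq q (true, x).
    by rewrite qx same_block_sym in pq *; rewrite (H p).
  have E r : r != (true, x) -> glue u v' r = glue u v r.
    by case: r => -[] // i; rewrite xpair_eqE /= => /vv'.
  by rewrite !E //; apply: uv.
(* Recolouring only [x] in the zero colouring leaves it compatible, so no other node can share the
   block of [x]. *)
have /compatP/(_ _ _ xq) : compat d [ffun=> false] [ffun i => i == x].
  apply: H (compat_const d false) _ => i /negPf ix.
  by rewrite !ffunE ix.
case: q xq => -[] i _; rewrite /glue /= !ffunE eqxx //.
by move/esym/eqP->.
Qed.

(** This incompatibility is why dropping constraints from [C :\ c] to [C'] changes nothing on
    violators of [c]. *)
Lemma viol_single_pair x y d : x != y -> viol (x, x) d ->
  viol (x, y) d = false /\ viol (y, x) d = false.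
Proof.
move=> xy; rewrite /viol eqxx /= [y == x]eq_sym (negPf xy) => /singletonP H.
by split; apply/negbTE/negP; rewrite 1?[same_block _ (true, y) _]same_block_sym;
  case/H => yx; rewrite yx eqxx in xy.
Qed.

Lemma viol_dcomp c a b : viol c b -> viol c (dcomp a b).
Proof.
case: c => x y; have [->|xy] := eqVneq x y.
  move=> /viol_singleP vb; apply/viol_singleP => u v v' /compat_dcomp[w uw wv] vv'.
  by apply: compat_pair uw _; apply: vb wv vv'.
move=> /(viol_pairP _ xy) vb; apply/(viol_pairP _ xy) => u v /compat_dcomp[w _].
exact: vb.
Qed.

Lemma viol_not_perm c d : viol c d -> is_perm d = false.
Proof.
case: c => x y V; apply/negP => /(is_permP true)[/separatedP tot /linkedP inj].
have [E|xy] := eqVneq x y.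
  rewrite {}E in V; move/viol_singleP: V => V.
  have /inj/ffunP/(_ y) : compat d [ffun=> false] [ffun i => i == y].
    by apply: V (compat_const d false) _ => i /negPf iy; rewrite !ffunE iy.
  by rewrite !ffunE eqxx.
have [u uv] := tot [ffun i => i == x].
have := (viol_pairP _ xy) V _ _ uv.
by rewrite !ffunE eqxx eq_sym (negPf xy).
Qed.

Lemma dcomp_fuse_viol x y d : x != y -> viol (x, y) d -> dcomp d (fuse x y) = d.
Proof.
move=> xy /(viol_pairP _ xy) V; apply: compat_ext => u v.
apply/compat_dcomp/idP => [[w uw]|uv].
  by rewrite compat_fuse => /andP[/eqP<-].
by exists v; rewrite // compat_fuse eqxx (V _ _ uv) /=.
Qed.

Lemma nmid_fuse x y d : nmid d (fuse x y) = 0%N.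
Proof.
apply: nmid_functional => v v' w.
by rewrite !compat_fuse => /andP[/eqP-> _] /andP[/eqP-> _].
Qed.

Lemma viol_fuse x y : x != y -> viol (x, y) (fuse x y).
Proof.
by move=> xy; apply/(viol_pairP _ xy) => u v; rewrite compat_fuse => /andP[/eqP-> /eqP].
Qed.

(** Fusing would attach a singleton [x] or [y] to the other node, hence the two exclusions; other
    singletons and all coincidences survive. *)
Lemma viol_dcomp_fuse x y c d : c != (x, x) -> c != (y, y) ->
  viol c d -> viol c (dcomp d (fuse x y)).
Proof.
case: c => i j; have [->|ij] := eqVneq i j.
  rewrite !xpair_eqE !andbb => jx jy /viol_singleP V.
  apply/viol_singleP => u v v' /compat_dcomp[w uw].
  rewrite compat_fuse => /andP[/eqP E /eqP wxy] vv'; subst w.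
  apply: (@compat_pair _ _ _ _ v'); first exact: V uw vv'.
  by rewrite compat_fuse eqxx -!vv' ?wxy ?eqxx // eq_sym.
move=> _ _ /(viol_pairP _ ij) V; apply/(viol_pairP _ ij) => u v /compat_dcomp[w uw].
by rewrite compat_fuse => /andP[/eqP<- _]; apply: V uw.
Qed.

Section SingletonRetraction.
Variables (x : 'I_n) (g : D).
Hypothesis gx : forall u v, compat g u v -> forall i, i != x -> u i = v i.

(** The last condition on [g] lifts a change of colour at [c.1] from right to left; it keeps a
    singleton of [d] a singleton of the product. *)
Lemma viol_dcomp_off c d : c.1 != x -> c.2 != x ->
  (forall u v v', compat g u v -> (forall j, j != c.1 -> v j = v' j) ->
     exists2 u', compat g u' v' & forall j, j != c.1 -> u j = u' j) ->
  viol c d -> viol c (dcomp d g).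
Proof.
case: c => i j /= ix jx gi; have [E|ij] := eqVneq i j.
  subst j => /viol_singleP V; apply/viol_singleP => u v v' /compat_dcomp[w uw wv] vv'.
  have [w' w'v' ww'] := gi _ _ _ wv vv'.
  by apply: compat_pair w'v'; apply: V uw ww'.
move=> /(viol_pairP _ ij) V; apply/(viol_pairP _ ij) => u v /compat_dcomp[w uw wv].
by rewrite -!(gx wv) //; apply: V uw.
Qed.

(** [d] ignores the colour of [x], the only one that [g] can alter. *)
Lemma dcomp_viol_single d : (forall v, exists u, compat g u v) ->
  viol (x, x) d -> dcomp d g = d.
Proof.
move=> tot /viol_singleP V; apply: compat_ext => u v.
apply/compat_dcomp/idP => [[w uw wv]|uv].
  by apply: V uw (gx wv).
have [w wv] := tot v; exists w => //; apply: V uv _ => i ix.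
by rewrite (gx wv).
Qed.

End SingletonRetraction.

Lemma viol_detach x z : x != z -> viol (x, x) (detach x z).
Proof.
move=> xz; apply/viol_singleP => u v v'.
rewrite !compat_detach // => /andP[-> /forallP uv] vv'.
by apply/forallP => i; apply/implyP => ix; rewrite -vv' //; apply: (implyP (uv i)).
Qed.

Lemma viol_cut x : viol (x, x) (cut x).
Proof.
apply/viol_singleP => u v v'; rewrite !compat_cut // => /forallP uv vv'.
by apply/forallP => i; apply/implyP => ix; rewrite -vv' //; apply: (implyP (uv i)).
Qed.

Lemma detach_off x z u v :
  x != z -> compat (detach x z) u v -> forall i, i != x -> u i = v i.
Proof.
move=> xz; rewrite compat_detach // => /andP[_ /forallP uv] i ix.
by apply/eqP; apply: (implyP (uv i)).
Qed.

Lemma cut_off x u v : compat (cut x) u v -> forall i, i != x -> u i = v i.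
Proof.
by rewrite compat_cut // => /forallP uv i ix; apply/eqP; apply: (implyP (uv i)).
Qed.

Lemma dcomp_detach_viol x z d : x != z -> viol (x, x) d -> dcomp d (detach x z) = d.
Proof.
move=> xz; apply: dcomp_viol_single => [u v|v]; first exact: detach_off.
exists [ffun i => if i == x then v z else v i].
rewrite compat_detach // !ffunE eqxx [z == x]eq_sym (negPf xz) eqxx /=.
by apply/forallP => i; apply/implyP => /negPf ix; rewrite ffunE ix.
Qed.

Lemma nmid_detach x z d : x != z -> nmid d (detach x z) = 0%N.
Proof.
move=> xz; apply: nmid_functional => v v' w vw v'w; apply/ffunP => i.
have [->|ix] := eqVneq i x; last by rewrite (detach_off xz vw) // (detach_off xz v'w).
move: (vw) (v'w); rewrite !compat_detach // => /andP[/eqP-> _] /andP[/eqP-> _].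
by rewrite (detach_off xz vw) 1?eq_sym // (detach_off xz v'w) // eq_sym.
Qed.

(** If [c.1] were [z], changing its colour would force that of the left node [x] as well; this is
    why [z] must be unconstrained. *)
Lemma viol_dcomp_detach x z c d : x != z ->
  c.1 != x -> c.2 != x -> c.1 != z -> viol c d -> viol c (dcomp d (detach x z)).
Proof.
move=> xz c1x c2x c1z; apply: (viol_dcomp_off (x := x)) => // [u v|u v v' uv vv'].
  exact: detach_off.
exists [ffun i => if i == c.1 then v' i else u i]; last first.
  by move=> j /negPf jc; rewrite ffunE jc.
move: (uv); rewrite !compat_detach // => /andP[uxz _].
rewrite !ffunE ![_ == c.1]eq_sym (negPf c1x) (negPf c1z) uxz /=.
apply/forallP => i; apply/implyP => ix; rewrite ffunE.
by case: (eqVneq i c.1) => [//|ic]; rewrite -vv' // (detach_off xz uv).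
Qed.

Lemma dcomp_cut_viol x d : viol (x, x) d -> dcomp d (cut x) = d.
Proof.
apply: dcomp_viol_single => [u v|v]; first exact: cut_off.
exists v; rewrite compat_cut; apply/forallP => i.
by apply/implyP.
Qed.

(** Over the zero colourings the middle row can be zero or the indicator of [x]: two colourings,
    hence one component and one factor [delta] to divide by. *)
Lemma nmid_cut_viol x d : viol (x, x) d -> nmid d (cut x) = 1%N.
Proof.
move=> /viol_singleP V; apply/eqP; rewrite -(eqn_exp2l (m := 2)) //.
rewrite (nmid_count (compat_const _ false)); apply/eqP.
rewrite (bigD1 [ffun=> false]) //= !compat_const.
have nx : [ffun i => i == x] != [ffun=> false] :> colouring.
  by apply/eqP => /ffunP/(_ x); rewrite !ffunE eqxx.
rewrite (bigD1 [ffun i => i == x]) //= big1 ?addn0 => [|v /andP[v0 vx]].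
  rewrite (V _ _ _ (compat_const d false)) => [|i /negPf ix]; last by rewrite !ffunE ix.
  rewrite compat_cut; case: forallP => // -[] i; apply/implyP => /negPf ix.
  by rewrite !ffunE ix.
apply/eqP; rewrite eqb0; apply/negP => /andP[_ /cut_off vc].
case/negP: (v0); apply/eqP/ffunP => i; rewrite [RHS]ffunE.
have [->|ix] := eqVneq i x; last by rewrite vc // ffunE.
case E: (v x) => //; case/negP: vx; apply/eqP/ffunP => j; rewrite ffunE.
by have [->|jx] := eqVneq j x; last by rewrite vc // ffunE.
Qed.

Lemma viol_dcomp_cut x c d :
  c.1 != x -> c.2 != x -> viol c d -> viol c (dcomp d (cut x)).
Proof.
move=> c1x c2x; apply: (viol_dcomp_off (x := x)) => // [u v|u v v' uv vv'].
  exact: cut_off.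
exists [ffun i => if i == c.1 then v' i else u i]; last first.
  by move=> j /negPf jc; rewrite ffunE jc.
rewrite compat_cut.
apply/forallP => i; apply/implyP => ix; rewrite ffunE.
by case: (eqVneq i c.1) => [//|ic]; rewrite -vv' // (cut_off uv).
Qed.

End Constraints.
End DiagramConstraints.

(** * Vanishing for the partition algebra *)

Section PartitionAlgebraBar.
Variables (R : comPzRingType) (delta : R) (n : nat).
Local Notation D := (diagram n).
Implicit Types (a b d x : D).

Definition struct_const : D -> D -> D -> R :=
  monomial_const (@dcomp n) (fun a b => delta ^+ nmid a b).

Local Notation k := struct_const.
Local Notation e := (eps (n := n) R).

Lemma struct_constA a b d x :
  \sum_y k a b y * k y d x = \sum_y k b d y * k a y x.
Proof.
apply: monomial_constA => [|p q r]; first exact: dcompA.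
by rewrite -!exprD nmidA.
Qed.

Lemma struct_const_id a x : k a (id_diagram n) x = (a == x)%:R.
Proof. by rewrite /k /monomial_const dcomp_id nmid_id; case: eqP. Qed.

Lemma struct_const_eps a b : \sum_x k a b x * e x = e a * e b.
Proof.
rewrite sum_monomial_const /eps is_perm_dcomp.
case pa: (is_perm a); last by rewrite mul0r mulr0.
by rewrite nmid_perml // !mul1r.
Qed.

Local Notation acyclic := (acyclic k e).

Lemma eq_acyclic (V W : pred D) : V =1 W -> acyclic V -> acyclic W.
Proof.
move=> VW acV F dF; have [a s|G dG] := acV F; first by rewrite VW; apply: dF.
by exists G => a b s; rewrite -VW; apply: dG.
Qed.

Lemma left_ideal_struct_const (V : pred D) :
  (forall a b, V b -> V (dcomp a b)) -> left_ideal k V.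
Proof.
move=> idV a b x /idV-/(_ a) Vab Vx; rewrite /k /monomial_const.
by case: eqP Vx => // <-; rewrite Vab.
Qed.

Lemma left_ideal_viol c : left_ideal k (viol c : pred D).
Proof. by apply: left_ideal_struct_const => a b; apply: viol_dcomp. Qed.

Lemma left_ideal_violates C : left_ideal k (violates C : pred D).
Proof.
apply: left_ideal_struct_const => a b /existsP[c /andP[cC cb]].
by apply/existsP; exists c; rewrite cC viol_dcomp.
Qed.

(** The case of [acyclicU] where [V], [V'] and [W] are the violators of [C :\ c], of [C'] and of
    [c]. *)
Lemma acyclic_viol_step (C C' : {set 'I_n * 'I_n}) c r (g : D) :
  c \in C -> acyclic (violates (C :\ c)) -> acyclic (violates C') ->
  C' \subset C :\ c ->
  (forall c' d, c' \in C :\ c -> viol c d -> viol c' d -> c' \in C') ->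
  (forall c' d, c' \in C' -> viol c' d -> viol c' (dcomp d g)) ->
  viol c g ->
  (forall d, viol c d -> dcomp d g = d /\ r * delta ^+ nmid d g = 1) ->
  acyclic (violates C).
Proof.
move=> cC acC acC' /subsetP sC' CC' C'g cg gK.
have VE : predU (violates (C :\ c)) (viol c) =1 violates C.
  move=> d; apply/orP/existsP => [[/existsP[c' /andP[/setD1P[_ c'C] c'd]]|cd]|].
  - by exists c'; rewrite c'C.
  - by exists c; rewrite cC.
  case=> c' /andP[c'C c'd]; have [<-|c'c] := eqVneq c' c; [by right | left].
  by apply/existsP; exists c'; rewrite !inE c'c c'C.
apply: (eq_acyclic VE).
apply: (acyclicU (r := r) (g := g) struct_constA struct_const_eps _ _ _ _ acC acC' cg).
- exact: left_ideal_violates.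
- exact: left_ideal_violates.
- exact: left_ideal_viol.
- move=> d cd; apply/existsP/existsP => -[c' /andP[c'C c'd]];
    exists c'; rewrite c'd andbT.
    exact: CC' c'd.
  exact: sC'.
- move=> d x /existsP[c' /andP[c'C c'd]] Vx; rewrite /k /monomial_const.
  case: eqP Vx => // <- /negP[].
  by apply/existsP; exists c'; rewrite c'C C'g.
- move=> d x cd; have [dg nd] := gK d cd.
  by rewrite /k /monomial_const dg; case: eqP => _; rewrite ?mulr0.
by move=> d /viol_not_perm; rewrite /eps => ->.
Qed.

Lemma acyclic_violates (C : {set 'I_n * 'I_n}) :
  (exists r : R, delta * r = 1) \/
    (exists z, forall c, c \in C -> c.1 != z /\ c.2 != z) ->
  acyclic (violates C).
Proof.
have [m] := ubnP #|C|; elim: m C => // m IH C leC hyp.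
have [->|[c cC]] := set_0Vmem C.
  apply: eq_acyclic (acyclic0 (one := id_diagram n) struct_const_id) => d.
  by apply/esym/existsP => -[c]; rewrite inE.
(* Both [C :\ c] and the later [C'] are covered, since a constraint-free [z] stays so for
   subsets. *)
have IH' (C' : {set 'I_n * 'I_n}) : C' \subset C :\ c -> acyclic (violates C').
  move=> sC'; apply: IH.
    by apply: leq_ltn_trans (subset_leq_card sC') _; move: leC; rewrite (cardsD1 c C) cC.
  case: hyp => [|[z zC]]; [by left | right; exists z => c' c'C'].
  by apply: zC; move/subsetP/(_ _ c'C'): sC'; case/setD1P.
have acC := IH' _ (subxx _).
case: c cC IH' acC => x y cC IH' acC; have [E|xy] := eqVneq x y.
  subst y; pose C' := [set c in C :\ (x, x) | (c.1 != x) && (c.2 != x)].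
  have sC' : C' \subset C :\ (x, x) by apply/subsetP => c; rewrite inE => /andP[].
  have CC' c d : c \in C :\ (x, x) -> viol (x, x) d -> viol c d -> c \in C'.
    case: c => i j cx Vx Vc; rewrite inE cx /=; apply/andP.
    split; apply/eqP => E; subst; case/setD1P: cx => ne _.
      have xj : x != j by apply: contraNneq ne => ->.
      by have [] := viol_single_pair xj Vx; rewrite Vc.
    have xi : x != i by apply: contraNneq ne => ->.
    by have [] := viol_single_pair xi Vx; rewrite Vc.
  case: hyp => [[r dr]|[z zC]].
    apply: (acyclic_viol_step (r := r) (g := cut x) cC acC (IH' _ sC') sC' CC').
    - by move=> c d; rewrite inE => /and3P[_ c1 c2]; apply: viol_dcomp_cut.
    - exact: viol_cut.
    by move=> d Vd; rewrite dcomp_cut_viol // nmid_cut_viol // mulrC.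
  have xz : x != z by have [] := zC _ cC.
  apply: (acyclic_viol_step (r := 1) (g := detach x z) cC acC (IH' _ sC') sC' CC').
  - move=> c d; rewrite inE => /and3P[/setD1P[_ /zC[cz _]] c1 c2].
    exact: viol_dcomp_detach.
  - exact: viol_detach.
  by move=> d Vd; rewrite dcomp_detach_viol // nmid_detach // mul1r.
pose C' := [set c in C :\ (x, y) | (c != (x, x)) && (c != (y, y))].
have sC' : C' \subset C :\ (x, y) by apply/subsetP => c; rewrite inE => /andP[].
apply: (acyclic_viol_step (r := 1) (g := fuse x y) cC acC (IH' _ sC') sC').
- move=> c d cxy Vxy Vc; rewrite inE cxy /=; apply/andP.
  split; apply/eqP => E; subst c.
    by have [] := viol_single_pair xy Vc; rewrite Vxy.
  by have [] := viol_single_pair (_ : y != x) Vc; rewrite ?Vxy // eq_sym.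
- by move=> c d; rewrite inE => /and3P[_ cx cy]; apply: viol_dcomp_fuse.
- exact: viol_fuse.
by move=> d Vd; rewrite dcomp_fuse_viol // nmid_fuse mul1r.
Qed.

End PartitionAlgebraBar.

(** * From words of diagrams back to the chain groups defining Tor *)

Section Comparison.
Variables (R : comPzRingType) (delta : R) (n : nat).
Local Notation D := (diagram n).
Local Notation k := (struct_const delta (n := n)).
Local Notation e := (eps (n := n) R).
Implicit Types (t w : seq D) (F : seq D -> R).

Variable X : {set 'I_n}.
Local Notation N := (Nbasis X).

Definition word (u : seq D * N) : seq D := rcons u.1 (val u.2).

Lemma eq_word (u v : seq D * N) : (word u == word v) = (u == v).
Proof. by case: u v => s b [t c]; rewrite /word eqseq_rcons xpair_eqE val_eqE. Qed.

(** The faces of [dbasis] are matched one by one with those in [bnd]: the first with the [e] term,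
    the inner ones by [bar_indicator], and the action on [b] with its last summand. *)
Lemma coefl_indicator (s : seq D) (b : N) (v : seq D * N) : s != [::] ->
  coefl (dbasis delta s b) v = bnd k e (fun w => (w == word (s, b))%:R) (word v).
Proof.
case: s => // a1 r _; set s := a1 :: r.
have coefE (l : seq (R * (seq D * N))) :
    coefl l v = \sum_(p <- l) p.1 * (word p.2 == word v)%:R.
  rewrite /coefl big_mkcond; apply: eq_bigr => p _; rewrite eq_word.
  by case: eqP; rewrite ?mulr1 ?mulr0.
rewrite coefE /dbasis -/s big_cons big_cat /= /bnd; congr (_ + _).
  rewrite (bigD1 a1) //= big1 ?addr0 => [|a /negPf aa1].
    by rewrite /word /= eqseq_cons eqxx eq_sym.
  by rewrite /word /= eqseq_cons aa1 mulr0.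
rewrite (bar_indicator (@dcomp n) (fun a b => delta ^+ nmid a b) a1).
rewrite size_rcons /= big_ord_recr /= opprD; congr (_ + _).
  rewrite big_map -[size r]subn0 -/(index_iota 0 (size r)) big_mkord subn0 -sumrN.
  apply: eq_bigr => i _; rewrite /word /= -!rcons_cons -/s.
  have ir := ltn_ord i; have lis : (i < size s)%N := ltnW ir.
  rewrite !nth_rcons ir lis drop_rcons // -[rcons s _]cats1 takel_cat; last exact: ltnW.
  by rewrite exprS mulN1r !mulNr -rcons_cons -rcons_cat.
rewrite big_map /word /= -!rcons_cons -/s /act.
have sE : s = rcons (belast a1 r) (last a1 r) by rewrite /s lastI.
have sr : size (belast a1 r) = size r by rewrite size_belast.
have nr : nth a1 (rcons s (val b)) (size r) = last a1 r.
  by rewrite nth_rcons /= ltnS leqnn -[size r]/((size s).-1) nth_last.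
have nr1 : nth a1 (rcons r (val b)) (size r) = val b.
  by rewrite nth_rcons ltnn eqxx.
rewrite nr nr1 drop_oversize ?size_rcons // cats1.
have -> : take (size r) (rcons s (val b)) = belast a1 r.
  by rewrite sE -!cats1 -catA -sr take_size_cat.
case: insubP => [b' _ bb'|/negPn Jb].
  by rewrite big_seq1 /= -bb' exprS mulN1r !mulNr.
(* A product falling into the ideal contributes nothing to [act], and its word differs from
   [word v], whose last letter lies outside the ideal. *)
rewrite big_nil eqseq_rcons [X in _ && X](_ : _ = false) ?andbF ?mulr0 ?oppr0 //.
apply/negP => /eqP E; have : ~~ inJ X (sval v.2) := valP v.2.
by rewrite -E Jb.
Qed.

Definition extend i (f : chain R X i) : seq D -> R :=
  fun w => \sum_u f u * (w == word (val u.1, u.2))%:R.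

Lemma extend_word i (f : chain R X i) (u : i.-tuple D * N) :
  extend f (word (val u.1, u.2)) = f u.
Proof.
rewrite /extend (bigD1 u) //= big1 ?addr0 => [|v vu]; first by rewrite eqxx mulr1.
rewrite eq_word xpair_eqE val_eqE; case: u v vu => s b [t c]; rewrite xpair_eqE.
by rewrite [s == t]eq_sym [b == c]eq_sym => /negPf->; rewrite mulr0.
Qed.

Lemma extend_size i (f : chain R X i) w : size w != i.+1 -> extend f w = 0.
Proof.
move=> sw; rewrite /extend big1 // => u _.
rewrite (_ : (_ == _) = false) ?mulr0 //; apply: contraNF sw => /eqP->.
by rewrite size_rcons size_tuple.
Qed.

Lemma bd_extend i (f : chain R X i.+1) (t : i.-tuple D * N) :
  bd delta f t = bnd k e (extend f) (word (val t.1, t.2)).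
Proof.
rewrite ffunE /extend bnd_lin; apply: eq_bigr => u _.
by rewrite coefl_indicator // -size_eq0 size_tuple.
Qed.

Lemma wordP i w : size w = i.+1 -> ~~ inJ X (last (id_diagram n) w) ->
  exists t : i.-tuple D * N, w = word (val t.1, t.2).
Proof.
case/lastP: w => // s a; rewrite size_rcons last_rcons => -[si] aJ.
by exists (tcast si (in_tuple s), Sub a aJ); rewrite /word /= val_tcast SubK.
Qed.

Lemma Tor_vanishes_acyclic :
  acyclic k e (inJ X : pred D) -> left_ideal k (inJ X : pred D) ->
  forall i, (0 < i)%N -> Tor_vanishes delta X i.
Proof.
move=> acJ idJ [//|i] _ f df.
have [a s lJ|G dG] := acJ (extend f).
  have [si|si] := eqVneq (size s).+1 i.+1.
    have [t ->] := @wordP i (a :: s) si lJ.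
    by rewrite -bd_extend df ffunE.
  rewrite -[RHS](mul0r (bnd k e (extend f) (a :: s))) -bndZ.
  by apply: eq_bnd => w sw; rewrite extend_size ?mul0r // sw.
exists [ffun u => G (word (val u.1, u.2))]; apply/ffunP => t; rewrite bd_extend.
set g := finfun _; set w := word _.
have [b [c [s wE]]] : exists b c s, w = [:: b, c & s].
  have: size w = i.+2 by rewrite size_rcons size_tuple.
  by case: w => [|b [|c s]] // _; exists b, c, s.
have lw : ~~ inJ X (last c s).
  rewrite -[last c s]/(last b (c :: s)) -[last b _]/(last b (b :: c :: s)) -wE.
  by rewrite last_rcons; exact: (valP t.2).
rewrite -[RHS]extend_word -/w wE -dG //; apply/eqP; rewrite -subr_eq0 -bndB; apply/eqP.
(* In the relevant length, [extend g] and [G] differ only on words ending in the left ideal, which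
   cannot affect the boundary on [w]. *)
pose h w' := if size w' == i.+3 then extend g w' - G w' else 0.
have hJ : ends_in (inJ X : pred D) h.
  move=> a u lJ; rewrite /h; case: eqP => // su.
  have [t' ->] := @wordP i.+2 (a :: u) su lJ.
  by rewrite extend_word ffunE subrr.
rewrite -[RHS](bnd_ends_in e idJ hJ (a := b) (s := c :: s) lw).
have sw : size w = i.+2 by rewrite size_rcons size_tuple.
by apply: eq_bnd => u; rewrite -wE sw /h => ->; rewrite eqxx.
Qed.

End Comparison.

Theorem theorem4p2 (R : comPzRingType) (delta : R) (n : nat) (X : {set 'I_n}) :
  (exists e : R, delta * e = 1) \/ (#|X| < n)%N ->
  forall i : nat, (0 < i)%N -> Tor_vanishes delta X i.
Proof.
move=> hyp.
have JE : inJ X =1 violates (setX X X) by move=> d; rewrite inJE.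
apply: Tor_vanishes_acyclic; last first.
  by move=> a b x; rewrite !JE; apply: left_ideal_violates.
apply: (eq_acyclic (V := violates (setX X X))) => [d|]; first by rewrite JE.
apply: acyclic_violates; case: hyp => [|Xn]; [by left | right].
have /set0Pn[z] : ~: X != set0.
  by rewrite -card_gt0 cardsCs setCK card_ord subn_gt0.
rewrite inE => zX; exists z => -[x y] /setXP[xX yX] /=.
by split; [apply: contraNneq zX => <- | apply: contraNneq zX => <-].
Qed.
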